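(* Let $X=\sum_{\alpha\in\mathcal X}I_\alpha$, $\mu=\mathbb E X$, $\Pi$, $\delta$ and $\varphi$ be as defined in the context. If $\varepsilon\in[0,1]$, $\Pi<1$ and $\varepsilon^2\mu\ge\mathbf 1_{\{\varepsilon<1/50\}}(1+\delta)^{-1/2}$, then $$\mathbb P(X\le(1-\varepsilon)\mathbb E X)\ \ge\ \exp\{-K\varphi(-\varepsilon)\mu(1+\delta^* )\}\ \ge\ \exp\{-K\varepsilon^2\mu(1+\delta^* )\},$$ with $K=5000/(1-\Pi)^5$ and $\delta^*=\mathbf 1_{\{\varepsilon<1/50\}}\delta$.
   Context: Setting: $\Gamma$ is a finite set with $|\Gamma|=N$, $\mathbf p=(p_i)_{i\in\Gamma}\in[0,1]^N$, and $\Gamma_{\mathbf p}\subseteq\Gamma$ is the random subset in which each $i\in\Gamma$ is included independently with probability $p_i$. $(Q(\alpha))_{\alpha\in\mathcal X}$ is a family of subsets of $\Gamma$ indexed by a finite nonempty set $\mathcal X$, $I_\alpha=\mathbf 1_{\{Q(\alpha)\subseteq\Gamma_{\mathbf p}\}}$, and $X=\sum_{\alpha\in\mathcal X}I_\alpha$. Write $\alpha\sim\beta$ if $\alpha\ne\beta$ and $Q(\alpha)\cap Q(\beta)\neq\emptyset$. Put $\mu=\mathbb E X$, $\Pi=\max_{\alpha\in\mathcal X}\mathbb E I_\alpha$, $\Lambda=\mu+\sum_{(\alpha,\beta)\in\mathcal X\times\mathcal X:\,\alpha\sim\beta}\mathbb E I_\alpha I_\beta$, and define $\delta\ge0$ by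 $\Lambda=(1+\delta)\mu$ (if $\mu=0$, so $\Lambda=0$, put $\delta=0$). The function $\varphi$ is $\varphi(x)=(1+x)\log(1+x)-x$ for $x\ge -1$, with $\varphi(-1)=1$. $\mathbf 1_{\{A\}}$ equals $1$ if $A$ holds and $0$ otherwise. *)

(* Defs.v *)
From HB Require Import structures.
From mathcomp Require Import all_boot all_order all_algebra.
From mathcomp Require Import reals exp.

Set Implicit Arguments.
Unset Strict Implicit.
Unset Printing Implicit Defensive.

Import Order.TTheory GRing.Theory Num.Theory.
Local Open Scope ring_scope.

(* The law of the random subset of Gamma that contains each i independently
   with probability p i, as a mass function on {set Gamma}. *)
Definition subset_law (R : realType) (Gamma : finType) (p : Gamma -> R)
    (S : {set Gamma}) : R :=
  \prod_(i : Gamma) (if i \in S then p i else 1 - p i).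

Definition Ex (R : realType) (Gamma : finType) (p : Gamma -> R)
    (f : {set Gamma} -> R) : R :=
  \sum_(S : {set Gamma}) subset_law p S * f S.

Definition Pr (R : realType) (Gamma : finType) (p : Gamma -> R)
    (A : pred {set Gamma}) : R :=
  \sum_(S : {set Gamma} | A S) subset_law p S.

Section Family.
Variables (R : realType) (Gamma X : finType).
Variables (p : Gamma -> R) (Q : X -> {set Gamma}).

Definition Ind (a : X) (S : {set Gamma}) : R := (Q a \subset S)%:R.

Definition Xsum (S : {set Gamma}) : R := \sum_(a : X) Ind a S.

Definition mu : R := Ex p Xsum.

(* The expectations are nonnegative, so for nonempty X the default value 0
   does not affect the maximum. *)
Definition Pimax : R := \big[Num.max/0]_(a : X) Ex p (Ind a).

(* Distinct indices are required, not distinct sets: Q need not be injective. *)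
Definition dependent (a b : X) : bool := (a != b) && (Q a :&: Q b != set0).

Definition Lambda : R :=
  mu + \sum_(ab : X * X | dependent ab.1 ab.2)
         Ex p (fun S => Ind ab.1 S * Ind ab.2 S).

Definition delta : R := if mu == 0 then 0 else Lambda / mu - 1.

End Family.

(* Since ln 0 = 0 here, phi (-1) = 1. *)
Definition phi (R : realType) (x : R) : R := (1 + x) * ln (1 + x) - x.

Lemma phiN1 (R : realType) : phi (- 1 : R) = 1.
Proof. by rewrite /phi subrr mul0r sub0r opprK. Qed.

Lemma Pr_superset (R : realType) (Gamma : finType) (p : Gamma -> R)
    (A : {set Gamma}) :
  Pr p (fun S => A \subset S) = \prod_(i in A) p i.
Proof.
transitivity (\prod_(i : Gamma) (p i + (i \notin A)%:R * (1 - p i))).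
  rewrite bigA_distr /= /Pr /subset_law [RHS](bigID (fun S : {set Gamma} => A \subset S)) /=.
  rewrite [X in _ = _ + X]big1 ?addr0 => [|S /subsetPn[i iA iS]]; last first.
    by rewrite (bigD1 i) //= (negbTE iS) iA mul0r mul0r.
  apply: eq_bigr => S AS; apply: eq_bigr => i _.
  case: ifP => // iS; case: (boolP (i \in A)) => [/(subsetP AS)|]; last by rewrite mul1r.
  by rewrite iS.
rewrite [LHS](bigID (mem A)) /= [X in _ * X]big1 ?mulr1 => [|i ->].
  by apply: eq_bigr => i ->; rewrite mul0r addr0.
by rewrite mul1r addrCA subrr addr0.
Qed.

Section Sanity.
Variables (R : realType) (Gamma X : finType).
Variables (p : Gamma -> R) (Q : X -> {set Gamma}).
Hypothesis p01 : forall i, 0 <= p i <= 1.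

Lemma subset_law_ge0 S : 0 <= subset_law p S.
Proof.
by apply: prodr_ge0 => i _; case/andP: (p01 i) => ? ?; case: ifP => // _; rewrite subr_ge0.
Qed.

Lemma Ex_ge0 f : (forall S, 0 <= f S) -> 0 <= Ex p f.
Proof. by move=> f0; apply: sumr_ge0 => S _; rewrite mulr_ge0 ?subset_law_ge0. Qed.

Lemma mu_ge0 : 0 <= mu p Q.
Proof. by apply: Ex_ge0 => S; apply: sumr_ge0 => a _; apply: ler0n. Qed.

Lemma delta_ge0 : 0 <= delta p Q.
Proof.
rewrite /delta; case: eqP => // /eqP mu0.
have mup : 0 < mu p Q by rewrite lt_def mu0 mu_ge0.
rewrite subr_ge0 ler_pdivlMr // mul1r lerDl; apply: sumr_ge0 => ab _.
by apply: Ex_ge0 => S; rewrite mulr_ge0 ?ler0n.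
Qed.

Lemma LambdaE : Lambda p Q = (1 + delta p Q) * mu p Q.
Proof.
rewrite /delta; case: eqP => [mu0|/eqP mu0]; last by rewrite addrC subrK divfK.
rewrite mu0 mulr0 /Lambda mu0 add0r.
have EI a : Ex p (Ind R Q a) = 0.
  have : \sum_(b : X) Ex p (Ind R Q b) = 0.
    rewrite -[RHS]mu0 /mu /Ex exchange_big; apply: eq_bigr => S _.
    by rewrite -mulr_sumr.
  move/eqP; rewrite psumr_eq0 => [/allP/(_ a (mem_index_enum a))/eqP //|b _].
  by apply: Ex_ge0 => S; apply: ler0n.
apply: big1 => -[a b] _ /=; apply/eqP; rewrite eq_le; apply/andP; split.
  rewrite -(EI a); apply: ler_sum => S _; apply: ler_wpM2l; first exact: subset_law_ge0.
  by rewrite ler_piMr ?ler0n // /Ind lern1 leq_b1.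
by apply: Ex_ge0 => S; rewrite mulr_ge0 ?ler0n.
Qed.

End Sanity.

(* Main.v *)
(** Put [q = 1 - Pimax].  Harris' inequality gives
    [P(X = 0) >= prod_a (1 - E I_a) >= exp(- mu / q)], which suffices when
    [eps >= q^2 / 50], because [phi(- eps) >= eps^2 / 2].  For smaller [eps] let
    [s = 10 eps / q].  Harris' inequality bounds the Laplace transform below,
    [E exp(- s X) >= exp(- s mu + q s^2 mu / 5)], and since
    [q s / 5 = 2 eps] the part of this expectation carried by
    [X > (1 - eps) mu] is smaller by a factor [exp(- s eps mu)].  The
    Cauchy-Schwarz inequality against Janson's upper bound
    [E exp(- t X) <= exp(- t mu + t^2 Lambda / 2)] at [t = 2 s] then yields
    [P(X <= (1 - eps) mu) >= (s eps mu)^2 exp(- 2 s^2 Lambda)].  The prefactor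
    is absorbed by the hypothesis [eps^2 mu (1 + delta)^(1/2) >= 1]. *)

Require Import Defs.
From HB Require Import structures.
From mathcomp Require Import all_boot all_order all_algebra.
From mathcomp Require boolp.
From mathcomp Require Import reals topology normedtype derive realfun sequences exp.
From mathcomp Require Import ring lra.

Set Implicit Arguments.
Unset Strict Implicit.
Unset Printing Implicit Defensive.

Import Order.TTheory GRing.Theory Num.Theory.
Import numFieldNormedType.Exports.
Local Open Scope ring_scope.

(** * Exponential estimates *)

Section RealFunctions.
Variable R : realType.
Implicit Types (f df : R -> R) (x y : R).

Lemma le_at0_of_derive_le0 f df x :
  (forall y, is_derive y 1 f (df y)) -> (forall y, 0 <= y -> df y <= 0) ->
  0 <= x -> f x <= f 0.
Proof.
move=> fdf df0 x0; apply: (@ler0_derive1_nincry R f 0) => //.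
- move=> y; rewrite in_itv /= andbT => y0; rewrite derive1E; case: (fdf y) => _ ->.
  exact/df0/ltW.
- apply: continuous_subspaceT => y.
  by apply/differentiable_continuous/derivable1_diffP; case: (fdf y).
Qed.

Lemma is_derive_sum_seq (I : Type) (s : seq I) (F : I -> R -> R) (dF : I -> R) x :
  (forall i, is_derive x 1 (F i) (dF i)) ->
  is_derive x 1 (fun y => \sum_(i <- s) F i y) (\sum_(i <- s) dF i).
Proof.
move=> FdF; elim: s => [|i s IH].
  rewrite big_nil (_ : (fun _ => _) = fun=> 0); first exact: is_derive_cst.
  by apply: boolp.funext => y; rewrite big_nil.
rewrite big_cons (_ : (fun _ => _) = fun y => F i y + \sum_(i <- s) F i y).
  exact: (is_deriveD (FdF i) IH).
by apply: boolp.funext => y; rewrite big_cons.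
Qed.

Lemma is_derive_quad (a b x : R) :
  is_derive x 1 (fun y => a * y + b * y ^+ 2) (a + 2 * b * x).
Proof.
have ha : is_derive x 1 (fun y : R => a *: y) (a *: (1 : R)) by apply: is_deriveZ.
have h2 : is_derive x 1 (fun y : R => y ^+ 2) (2 * x).
  have h := is_deriveM (is_derive_id x (1 : R)) (is_derive_id x (1 : R)).
  by apply: is_derive_eq h _; rewrite /GRing.scale /=; ring.
have hb : is_derive x 1 (fun y : R => b *: y ^+ 2) (b *: (2 * x)) by apply: is_deriveZ.
by apply: is_derive_eq (is_deriveD ha hb) _; rewrite /GRing.scale /=; ring.
Qed.

Lemma is_derive_expR_quad (a b x : R) :
  is_derive x 1 (fun y => expR (a * y + b * y ^+ 2))
    (expR (a * x + b * x ^+ 2) * (a + 2 * b * x)).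
Proof.
exact: (is_derive1_comp (f := expR) (is_derive_expR _) (is_derive_quad a b x)).
Qed.

Lemma expR_ge_quad x : 0 <= x -> 1 + x + x ^+ 2 / 2 <= expR x.
Proof.
move=> x0; pose f := fun y : R => (1 * y + 2^-1 * y ^+ 2) - expR y.
suff : f x <= f 0 by rewrite /f expR0 expr0n /= ; lra.
apply: (@le_at0_of_derive_le0 f (fun y => (1 + 2 * 2^-1 * y) - expR y)) => // y.
  exact: (is_deriveB (is_derive_quad _ _ _) (is_derive_expR _)).
by move=> _; have := expR_ge1Dx y; lra.
Qed.

(** Since u - 1/u increases in u > 0, [expR x] may be replaced by its quadratic lower bound [d];
    then (d - 2x) d = 1 + x^4 / 4 >= 1 concludes. *)
Lemma expR_subN_ge x : 0 <= x -> 2 * x <= expR x - expR (- x).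
Proof.
move=> x0; have hE := expR_ge_quad x0; rewrite expRN.
set e := expR x in hE *; set d := 1 + x + x ^+ 2 / 2 in hE.
have d0 : 0 < d by rewrite /d; nra.
have de : e^-1 <= d^-1 by rewrite lef_pV2 // posrE (lt_le_trans d0).
suff : d^-1 <= d - 2 * x by lra.
rewrite -[leLHS]mul1r ler_pdivrMr //.
have -> : (d - 2 * x) * d = 1 + (x ^+ 2) ^+ 2 / 4 by rewrite /d; field.
by rewrite lerDl divr_ge0 // sqr_ge0.
Qed.

(** With u = 1 - x, [expR_subN_ge] at - ln u gives - 2 u ln u <= 1 - u^2, hence u ln u + 1 - u >= (1
    - u)^2 / 2. The endpoint x = 1, where [ln 0] is a default value, is treated apart. *)
Lemma phiN_ge x : 0 <= x <= 1 -> x ^+ 2 / 2 <= phi (- x).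
Proof.
move=> /andP[x0]; rewrite le_eqVlt => /predU1P[->|x1].
  by rewrite phiN1; lra.
rewrite /phi opprK; have u0 : 0 < 1 - x by lra.
have := @expR_subN_ge (- ln (1 - x)); rewrite opprK expRN lnK ?posrE //.
rewrite oppr_ge0 ln_le0 ?gerBl // => /(_ isT).
set l := ln _; set u := 1 - x in u0 l * => h.
have : u * (2 * - l) <= u * (u^-1 - u) by rewrite ler_pM2l.
rewrite mulrBr divff ?gt_eqF //.
have -> : x = 1 - u by rewrite /u; lra.
by nra.
Qed.

Lemma phiN_le x : 0 <= x <= 1 -> phi (- x) <= x ^+ 2.
Proof.
move=> /andP[x0]; rewrite le_eqVlt => /predU1P[->|x1].
  by rewrite phiN1 expr1n.
rewrite /phi opprK; have := @le_ln1Dx R (- x); rewrite ltrN2 => /(_ x1).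
by nra.
Qed.

(* The square of [1 + x / 2 <= expR (x / 2)]. *)
Lemma expR_ge_quarter x : - 2 <= x -> 1 + x + x ^+ 2 / 4 <= expR x.
Proof.
move=> x2; rewrite [expR x](_ : _ = expR (x / 2) ^+ 2); last first.
  by rewrite -expRM_natl; congr expR; field.
rewrite (_ : 1 + x + x ^+ 2 / 4 = (1 + x / 2) ^+ 2); last by field.
by rewrite lerXn2r ?nnegrE ?expR_ge0 ?expR_ge1Dx //; lra.
Qed.

Lemma expR_div1D_le y : 0 <= y -> expR (y / (1 + y)) <= 1 + y.
Proof.
move=> y0; have := expR_ge1Dx (- (y / (1 + y))).
have y1 : 0 < 1 + y by lra.
rewrite expRN (_ : 1 - y / (1 + y) = (1 + y)^-1); last by field; rewrite gt_eqF.
by rewrite lef_pV2 // posrE ?expR_gt0.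
Qed.

(** From 1 / (1 - y) = 1 + y / (1 - y) <= exp(y / (1 - y)) and 1 - y >= q. This bounds one factor of
    P(X = 0). *)
Lemma expRN_div_le y (q : R) : 0 <= y <= 1 - q -> 0 < q -> expR (- (y / q)) <= 1 - y.
Proof.
move=> /andP[y0 yq] q0; have y1 : 0 < 1 - y by lra.
have := expR_ge1Dx (y / (1 - y)).
rewrite (_ : 1 + y / (1 - y) = (1 - y)^-1); last by field; rewrite gt_eqF.
rewrite -[y / (1 - y)]opprK (expRN (- _)) lef_pV2 ?posrE ?expR_gt0 //.
apply: le_trans; rewrite ler_expR lerN2 ler_wpM2l // lef_pV2 ?posrE //; lra.
Qed.

(* Dividing by [expR (- (s * y))] centres the Bernoulli variable, so that the linear
   terms of the two quadratic lower bounds on [expR] cancel. *)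
Lemma Bernoulli_laplace_ge (s q y : R) :
  0 <= s <= 5^-1 -> 0 <= q -> 0 <= y <= 1 - q ->
  expR (- (s * y) + q / 5 * s ^+ 2 * y) <= 1 - y + y * expR (- s).
Proof.
move=> /andP[s0 s1] q0 /andP[y0 yq].
suff : expR (q / 5 * s ^+ 2 * y)
     <= (1 - y) * expR (s * y) + y * expR (- (s * (1 - y))).
  rewrite expRD => h; apply: le_trans (ler_wpM2l (expR_ge0 _) h) _.
  rewrite mulrDr !(mulrCA (expR _)) -!expRD.
  have -> : - (s * y) + s * y = 0 by ring.
  have -> : - (s * y) - s * (1 - y) = - s by ring.
  by rewrite expR0 mulr1.
have h1 : 1 + s * y + (s * y) ^+ 2 / 4 <= expR (s * y).
  by apply: expR_ge_quarter; nra.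
have h2 : 1 - s * (1 - y) + (- (s * (1 - y))) ^+ 2 / 4 <= expR (- (s * (1 - y))).
  by apply: expR_ge_quarter; nra.
(* [z] is the combined quadratic term: (1 - y) (s y)^2 / 4 + y (s (1 - y))^2 / 4. *)
pose z := s ^+ 2 * (y * (1 - y)) / 4.
have s2 : 0 <= s ^+ 2 <= 25^-1 by rewrite sqr_ge0 /=; nra.
have yy : 0 <= y * (1 - y) <= 1 by nra.
have z0 : 0 <= z by rewrite /z; nra.
have z1 : z <= 4^-1 by rewrite /z; nra.
apply: (@le_trans _ _ (1 + z)).
  apply: le_trans (expR_div1D_le z0); rewrite ler_expR.
  rewrite ler_pdivlMr; last lra.
  (* Here q <= 1 - y and 1 + z <= 5/4; the factor 5/4 turns the 1/5 of the statement into the 1/4 of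
     [z]. *)
  apply: (@le_trans _ _ ((1 - y) / 5 * s ^+ 2 * y * (5 / 4))).
    have c0 : 0 <= s ^+ 2 * y by nra.
    have -> : q / 5 * s ^+ 2 * y * (1 + z) = (s ^+ 2 * y / 5) * (q * (1 + z)) by ring.
    have -> : (1 - y) / 5 * s ^+ 2 * y * (5 / 4) = (s ^+ 2 * y / 5) * ((1 - y) * (5 / 4)) by ring.
    apply: ler_wpM2l; first lra.
    by apply: ler_pM; lra.
  by rewrite /z; lra.
have h3 : (1 - y) * (1 + s * y + (s * y) ^+ 2 / 4) <= (1 - y) * expR (s * y).
  by apply: ler_wpM2l => //; lra.
have h4 := ler_wpM2l y0 h2.
apply: le_trans (lerD h3 h4).
by rewrite -subr_ge0 (_ : _ - _ = 0) // /z; field.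
Qed.

End RealFunctions.

(** * Product measures and Harris' inequality *)

Section ProductMeasure.
Variables (R : realType) (Gamma : finType) (p : Gamma -> R).
Hypothesis p01 : forall i, 0 <= p i <= 1.
Implicit Types (f g : {set Gamma} -> R) (A S T : {set Gamma}).

Lemma eq_Ex f g : f =1 g -> Ex p f = Ex p g.
Proof. by move=> fg; apply: eq_bigr => S _; rewrite fg. Qed.

Lemma le_Ex f g : (forall S, f S <= g S) -> Ex p f <= Ex p g.
Proof.
by move=> fg; apply: ler_sum => S _; apply: ler_wpM2l; rewrite ?subset_law_ge0.
Qed.

Lemma ExD f g : Ex p (fun S => f S + g S) = Ex p f + Ex p g.
Proof. by rewrite -big_split /=; apply: eq_bigr => S _; rewrite mulrDr. Qed.

Lemma ExZ c f : Ex p (fun S => c * f S) = c * Ex p f.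
Proof. by rewrite mulr_sumr; apply: eq_bigr => S _; rewrite mulrCA. Qed.

Lemma Ex_sum (I : finType) (P : pred I) (F : I -> {set Gamma} -> R) :
  Ex p (fun S => \sum_(i | P i) F i S) = \sum_(i | P i) Ex p (F i).
Proof.
by rewrite /Ex exchange_big; apply: eq_bigr => S _; rewrite mulr_sumr.
Qed.

Lemma subset_law_total : \sum_S subset_law p S = 1.
Proof.
transitivity (Pr p (fun S => set0 \subset S)).
  by apply: eq_bigl => S; rewrite sub0set.
by rewrite Pr_superset big_set0.
Qed.

Lemma Ex_cst c : Ex p (fun=> c) = c.
Proof. by rewrite /Ex -mulr_suml subset_law_total mul1r. Qed.

Lemma PrE (P : pred {set Gamma}) : Pr p P = Ex p (fun S => (P S)%:R).
Proof.
by rewrite /Pr big_mkcond; apply: eq_bigr => S _; case: (P S); rewrite ?mulr1 ?mulr0.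
Qed.

(* Conditional expectation given the status of every element other than [i]. *)
Definition resample i f S := p i * f (i |: S) + (1 - p i) * f (S :\ i).

(** Each S without [i] is paired with [i |: S]; the product over j != i is their common weight. *)
Lemma Ex_split i f : Ex p f =
  \sum_(S : {set Gamma} | i \notin S)
     (\prod_(j | j != i) (if j \in S then p j else 1 - p j)) * resample i f S.
Proof.
rewrite /Ex (bigID (fun S : {set Gamma} => i \in S)) /=.
rewrite (reindex_onto (fun S => i |: S) (fun S => S :\ i)) /=; last first.
  by move=> S iS; rewrite setD1K.
rewrite (eq_bigl (fun S : {set Gamma} => i \notin S)) => [|S]; last first.
  rewrite setU11 /=; apply/eqP/idP => [<-|iS]; first by rewrite !inE eqxx.
  by rewrite setU1K.
rewrite -big_split /=; apply: eq_bigr => S iS.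
have lawD1 T : subset_law p T = (if i \in T then p i else 1 - p i) *
    \prod_(j | j != i) (if j \in T then p j else 1 - p j).
  by rewrite /subset_law (bigD1 i).
rewrite !lawD1 setU11 (negbTE iS) /resample.
under eq_bigr => j ji do rewrite in_setU1 (negbTE ji) /=.
have -> : S :\ i = S.
  by apply/setP => j; rewrite !inE; case: eqP => // ->; rewrite (negbTE iS).
by ring.
Qed.

Lemma resample_idem i f : resample i (resample i f) =1 resample i f.
Proof.
move=> S; rewrite /resample.
have -> : i |: (i |: S) = i |: S by apply/setP => j; rewrite !inE; case: eqP.
have -> : (i |: S) :\ i = S :\ i by apply/setP => j; rewrite !inE; case: eqP.
have -> : i |: (S :\ i) = i |: S by apply/setP => j; rewrite !inE; case: eqP.
have -> : (S :\ i) :\ i = S :\ i by apply/setP => j; rewrite !inE; case: eqP.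
by ring.
Qed.

Lemma Ex_resample i f : Ex p (resample i f) = Ex p f.
Proof.
by rewrite !(Ex_split i); apply: eq_bigr => S _; rewrite resample_idem.
Qed.

Definition decreasing f := forall S T : {set Gamma}, S \subset T -> f T <= f S.

Lemma resample_decreasing i f : decreasing f -> decreasing (resample i f).
Proof.
move=> df S T ST; have /andP[p0 p1] := p01 i.
by apply: lerD; apply: ler_wpM2l; rewrite ?subr_ge0 //; apply: df;
  rewrite ?setUS ?setSD.
Qed.

(** Chebyshev's inequality on two points: the difference of the sides is p (1 - p) times the product
    of the increments of [f] and [g], which have the same sign. *)
Lemma resampleM_ge i f g : decreasing f -> decreasing g ->
  forall S, resample i f S * resample i g S <= resample i (fun S => f S * g S) S.
Proof.
move=> df dg S; have /andP[p0 p1] := p01 i.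
have sub : S :\ i \subset i |: S.
  by apply/subsetP => j; rewrite !inE => /andP[_ ->]; rewrite orbT.
rewrite -subr_ge0 /resample.
have := df _ _ sub; have := dg _ _ sub.
move: (f (i |: S)) (f (S :\ i)) (g (i |: S)) (g (S :\ i)) => a b c d cd ab.
have -> : p i * (a * c) + (1 - p i) * (b * d)
  - (p i * a + (1 - p i) * b) * (p i * c + (1 - p i) * d)
  = p i * (1 - p i) * ((b - a) * (d - c)) by ring.
by rewrite !mulr_ge0 ?subr_ge0.
Qed.

Definition resamples (l : seq Gamma) f := foldr resample f l.

Lemma Ex_resamples l f : Ex p (resamples l f) = Ex p f.
Proof. by elim: l => //= i l IH; rewrite Ex_resample. Qed.

Lemma resamples_decreasing l f : decreasing f -> decreasing (resamples l f).
Proof. by move=> df; elim: l => //= i l; apply: resample_decreasing. Qed.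

(** Resampling [l] erases the dependence on the elements of [l]. For the full enumeration the result
    is therefore constant, equal to the expectation. *)
Lemma resamples_eq (l : seq Gamma) f S T :
  (forall j, j \notin l -> (j \in S) = (j \in T)) ->
  resamples l f S = resamples l f T.
Proof.
elim: l S T => [|i l IH] S T ST /=.
  by congr f; apply/setP => j; apply: ST.
by rewrite /resample; congr (_ * _ + _ * _); apply: IH => j jl;
  rewrite !inE; case: eqVneq => //= ji; apply: ST; rewrite inE negb_or ji.
Qed.

Lemma resamples_enum f S : resamples (enum Gamma) f S = Ex p f.
Proof.
rewrite -[LHS]Ex_cst -[RHS](Ex_resamples (enum Gamma)); apply: eq_Ex => T.
by apply: resamples_eq => j; rewrite mem_enum.
Qed.

Lemma resamplesM_le l f g : decreasing f -> decreasing g ->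
  Ex p (fun S => resamples l f S * resamples l g S) <= Ex p (fun S => f S * g S).
Proof.
move=> df dg; elim: l => //= i l; apply: le_trans.
rewrite -[leRHS](Ex_resample i); apply: le_Ex => S.
by apply: resampleM_ge; apply: resamples_decreasing.
Qed.

(* Resampling every element turns a function into its expectation, and each single
   resampling can only decrease the expectation of a product. *)
Lemma Harris f g : decreasing f -> decreasing g ->
  Ex p f * Ex p g <= Ex p (fun S => f S * g S).
Proof.
move=> df dg; apply: le_trans (resamplesM_le (enum Gamma) df dg).
by rewrite -[leLHS]Ex_cst; apply: le_Ex => S; rewrite !resamples_enum.
Qed.

(** Nonnegativity keeps the partial products decreasing, so Harris' inequality splits off one factor
    at a time. *)
Lemma Harris_prod (I : Type) (s : seq I) (F : I -> {set Gamma} -> R) :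
  (forall i, decreasing (F i)) -> (forall i S, 0 <= F i S) ->
  \prod_(i <- s) Ex p (F i) <= Ex p (fun S => \prod_(i <- s) F i S).
Proof.
move=> dF F0; elim: s => [|i s IH].
  by rewrite big_nil (eq_Ex (g := fun=> 1)) ?Ex_cst // => S; rewrite big_nil.
rewrite big_cons; apply: (@le_trans _ _ (Ex p (F i) * Ex p (fun S => \prod_(i <- s) F i S))).
  by apply: ler_wpM2l => //; apply: Ex_ge0.
rewrite [leRHS](eq_Ex (g := fun S => F i S * \prod_(i <- s) F i S)); last first.
  by move=> S; rewrite big_cons.
apply: Harris => // S T ST; elim: s {IH} => [|j s IH]; first by rewrite !big_nil.
rewrite !big_cons; apply: ler_pM => //; last exact: dF.
by apply: prodr_ge0.
Qed.

(** * Conditioning on inclusion, and the Cauchy-Schwarz inequality *)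

Lemma Ex_mem i f : Ex p (fun S => (i \in S)%:R * f S) = p i * Ex p (fun S => f (i |: S)).
Proof.
rewrite -(Ex_resample i) -ExZ; apply: eq_Ex => S.
by rewrite /resample !inE eqxx /= mul1r mul0r mulr0 addr0.
Qed.

(** By independence, conditioning on A being included amounts to adding A to the random set. The
    induction on the size of A forces in one element at a time. *)
Lemma Ex_superset A f :
  Ex p (fun S => (A \subset S)%:R * f S) = \prod_(i in A) p i * Ex p (fun S => f (A :|: S)).
Proof.
move: {2}#|A| (leqnn #|A|) => n; elim: n A f => [|n IH] A f.
  rewrite leqn0 cards_eq0 => /eqP->; rewrite big_set0 mul1r.
  by apply: eq_Ex => S; rewrite sub0set mul1r set0U.
case: (set_0Vmem A) => [->|[i iA]] An.
  by apply: IH; rewrite cards0.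
rewrite (eq_Ex (g := fun S => (i \in S)%:R * ((A :\ i \subset S)%:R * f S))); last first.
  move=> S; rewrite mulrA -natrM mulnb; congr (_%:R * _); congr nat_of_bool.
  by rewrite -[in LHS](setD1K iA) subUset sub1set.
rewrite Ex_mem (bigD1 i) //= -mulrA; congr (_ * _).
have sub S : (A :\ i \subset i |: S) = (A :\ i \subset S).
  apply/idP/idP => h; last by rewrite (subset_trans h) // subsetUr.
  apply/subsetP => j jA; have := subsetP h _ jA; move: jA.
  by rewrite !inE => /andP[/negbTE->].
rewrite (eq_Ex (g := fun S => (A :\ i \subset S)%:R * f (i |: S))); last first.
  by move=> S; rewrite sub.
rewrite (IH _ (fun S => f (i |: S))); last first.
  by move: An; rewrite (cardsD1 i) iA.
congr (_ * _); first by apply: eq_bigl => j; rewrite !inE andbC.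
by apply: eq_Ex => S; rewrite setUA setD1K.
Qed.

(** Expanding E (B 1_P - a f)^2 >= 0 yields B (P B - a^2) >= 0, as an indicator equals its
    square. *)
Lemma Cauchy_Schwarz_event (P : pred {set Gamma}) f :
  0 < Ex p (fun S => f S ^+ 2) ->
  Ex p (fun S => (P S)%:R * f S) ^+ 2 <= Pr p P * Ex p (fun S => f S ^+ 2).
Proof.
set B := Ex p (fun S => f S ^+ 2); set a := Ex p _ => B0.
have : 0 <= Ex p (fun S => (B * (P S)%:R - a * f S) ^+ 2).
  by apply: Ex_ge0 => // S; apply: sqr_ge0.
rewrite (eq_Ex (g := fun S => B ^+ 2 * (P S)%:R +
   (- (2 * a * B) * ((P S)%:R * f S) + a ^+ 2 * f S ^+ 2))); last first.
  by move=> S; case: (P S) => /=; ring.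
rewrite ExD ExD !ExZ -PrE -/a -/B.
have -> : B ^+ 2 * Pr p P + (- (2 * a * B) * a + a ^+ 2 * B)
   = B * (Pr p P * B - a ^+ 2) by ring.
by rewrite pmulr_rge0 // subr_ge0.
Qed.

End ProductMeasure.

(** * Laplace transform of the counting variable *)

Section Family.
Variables (R : realType) (Gamma X : finType).
Variables (p : Gamma -> R) (Q : X -> {set Gamma}).
Hypothesis p01 : forall i, 0 <= p i <= 1.
Implicit Types (a b : X) (S T : {set Gamma}) (s t eps : R).

Local Notation I := (Ind R Q).
Local Notation W := (Xsum R Q).
Local Notation laplace t := (Ex p (fun S => expR (- t * W S))).

Lemma Ind01 a S : 0 <= I a S <= 1.
Proof. by rewrite /Ind ler0n lern1 leq_b1. Qed.

Lemma Ind_increasing a S T : S \subset T -> I a S <= I a T.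
Proof.
move=> ST; rewrite /Ind ler_nat; case: (boolP (Q a \subset S)) => // aS.
by rewrite (subset_trans aS ST).
Qed.

Lemma Ex_Ind_ge0 a : 0 <= Ex p (I a).
Proof. by apply: Ex_ge0 => // S; case/andP: (Ind01 a S). Qed.

Lemma Ex_Ind_le_Pimax a : Ex p (I a) <= Pimax p Q.
Proof. by rewrite /Pimax (bigD1 a) //= le_max lexx. Qed.

Lemma Pimax_ge0 : 0 <= Pimax p Q.
Proof. by apply: (big_rec (fun x => 0 <= x)) => // a x _ x0; rewrite le_max x0 orbT. Qed.

Lemma Ex_IndM a (f : {set Gamma} -> R) :
  Ex p (fun S => I a S * f S) = Ex p (I a) * Ex p (fun S => f (Q a :|: S)).
Proof.
rewrite Ex_superset; congr (_ * _).
transitivity (Ex p (fun S => (Q a \subset S)%:R * 1)).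
  by rewrite (Ex_superset _ _ (fun=> 1)) Ex_cst mulr1.
by apply: eq_Ex => S; rewrite mulr1.
Qed.

Lemma muE : mu p Q = \sum_a Ex p (I a).
Proof. exact: Ex_sum. Qed.

(** The index [a] itself is included: the diagonal products I_a I_a = I_a then supply the summand mu
    of [Lambda]. *)
Definition nbhd a b : bool := (b == a) || dependent Q a b.

Definition local_sum a S : R := \sum_(b | nbhd a b) I b S.

Lemma local_sum_ge0 a S : 0 <= local_sum a S.
Proof. by apply: sumr_ge0 => b _; case/andP: (Ind01 b S). Qed.

Lemma Lambda_local : Lambda p Q = \sum_a Ex p (fun S => I a S * local_sum a S).
Proof.
rewrite /Lambda muE.
rewrite -(pair_big_dep xpredT (dependent Q)
  (fun a b => Ex p (fun S => I a S * I b S))) /= -big_split /=.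
apply: eq_bigr => a _; rewrite -Ex_sum -ExD; apply: eq_Ex => S.
rewrite /local_sum [in RHS](bigD1 a) /=; last by rewrite /nbhd eqxx.
rewrite mulrDr mulr_sumr; congr (_ + _).
  by rewrite /Ind; case: (_ \subset _); rewrite ?mulr1 ?mulr0.
apply: eq_bigl => b; rewrite /nbhd /dependent eq_sym.
by case: eqVneq => //=; rewrite ?andbT ?andbF.
Qed.

Lemma Ind_far a b S : ~~ nbhd a b -> I b (Q a :|: S) = I b S.
Proof.
rewrite /nbhd /dependent negb_or => /andP[ba].
rewrite eq_sym ba /= negbK => /eqP ab0.
rewrite /Ind; congr (nat_of_bool _)%:R; apply/idP/idP => h.
  apply/subsetP => i ib; have := subsetP h _ ib; rewrite inE => /orP[ia|//].
  by have := in_set0 i; rewrite -ab0 inE ia ib.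
by rewrite (subset_trans h) // subsetUr.
Qed.

(** The shift by [A] serves conditioning: given [Q a \subset S], the functions to be separated are
    evaluated at [Q a :|: S]. *)
Lemma expR_sum_decreasing t (P : pred X) (A : {set Gamma}) : 0 <= t ->
  decreasing (fun S => expR (- t * \sum_(b | P b) I b (A :|: S))).
Proof.
move=> t0 S T ST; rewrite ler_expR !mulNr lerN2 ler_wpM2l //.
by apply: ler_sum => b _; rewrite Ind_increasing // setUS.
Qed.

(* Given [Q a \subset S], the terms far from [a] keep their law, and Harris'
   inequality separates them from the terms near [a]. *)
Lemma tilted_Ind_ge a t : 0 <= t ->
  (Ex p (I a) - t * Ex p (fun S => I a S * local_sum a S)) * laplace t
  <= Ex p (fun S => I a S * expR (- t * W S)).
Proof.
move=> t0; pose far S := \sum_(b | ~~ nbhd a b) I b S.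
have WE S : W S = local_sum a S + far S by rewrite /Xsum (bigID (nbhd a)).
have farE S : far (Q a :|: S) = far S.
  by apply: eq_bigr => b; apply: Ind_far.
have dfar : laplace t <= Ex p (fun S => expR (- t * far S)).
  apply: le_Ex => // S; rewrite ler_expR !mulNr lerN2 ler_wpM2l // WE.
  by rewrite lerDr local_sum_ge0.
have lap0 : 0 <= laplace t by apply: Ex_ge0 => // S; apply: expR_ge0.
have dloc : Ex p (I a) - t * Ex p (fun S => I a S * local_sum a S)
    <= Ex p (fun S => I a S * expR (- t * local_sum a S)).
  rewrite -mulNr -ExZ -ExD; apply: le_Ex => // S.
  have /andP[I0 _] := Ind01 a S.
  have -> : I a S + - t * (I a S * local_sum a S)
    = I a S * (1 + - t * local_sum a S) by ring.
  by apply: ler_wpM2l => //; apply: expR_ge1Dx.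
(* The lower bound in [dloc] may be negative, so it is replaced before [laplace t] is enlarged to
   the transform of [far]. *)
apply: le_trans (ler_wpM2r lap0 dloc) _.
apply: le_trans (ler_wpM2l _ dfar) _.
  by apply: Ex_ge0 => // S; rewrite mulr_ge0 ?expR_ge0 //; case/andP: (Ind01 a S).
rewrite !Ex_IndM -mulrA; apply: ler_wpM2l; first exact: Ex_Ind_ge0.
rewrite [X in _ * X <= _](eq_Ex p (g := fun S => expR (- t * far (Q a :|: S)))); last first.
  by move=> S; rewrite farE.
apply: le_trans (Harris p01 (expR_sum_decreasing _ _ t0) (expR_sum_decreasing _ _ t0)) _.
by rewrite le_eqVlt; apply/orP; left; apply/eqP; apply: eq_Ex => S;
  rewrite -expRD -mulrDr -WE.
Qed.

Lemma tilted_mean_ge t : 0 <= t ->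
  (mu p Q - t * Lambda p Q) * laplace t <= Ex p (fun S => W S * expR (- t * W S)).
Proof.
move=> t0; rewrite [leRHS](eq_Ex p (g := fun S => \sum_a I a S * expR (- t * W S))).
  rewrite Ex_sum muE Lambda_local [t * _]mulr_sumr -sumrB mulr_suml.
  by apply: ler_sum => a _; apply: tilted_Ind_ge.
by move=> S; rewrite mulr_suml.
Qed.

(* [tilted_mean_ge] bounds the logarithmic derivative of the Laplace transform. *)
Lemma Janson_laplace_le t : 0 <= t ->
  laplace t <= expR (- (t * mu p Q) + t ^+ 2 / 2 * Lambda p Q).
Proof.
move=> t0; pose m := mu p Q; pose L := Lambda p Q.
(* [g] is the reciprocal of the claimed bound, so [h] has to stay below its value 1 at 0. *)
pose g u := expR (m * u + (- L / 2) * u ^+ 2).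
pose h u := laplace u * g u.
suff : h t <= h 0.
  have -> : h 0 = 1.
    rewrite /h /g expr0n /= !mulr0 addr0 expR0 mulr1 -[RHS](Ex_cst p).
    by apply: eq_Ex => S; rewrite oppr0 mul0r expR0.
  rewrite /h -ler_pdivlMr ?expR_gt0 // mul1r -expRN => /le_trans; apply.
  by rewrite ler_expR -/m -/L; lra.
pose dlap u := \sum_S subset_law p S * (- W S * expR (- u * W S)).
apply: (@le_at0_of_derive_le0 R h
   (fun u => laplace u * (g u * (m + 2 * (- L / 2) * u)) + g u * dlap u)) => // u.
  have hl : is_derive u 1 (fun v => laplace v) (dlap u).
    apply: is_derive_sum_seq => S.
    have e : is_derive u 1 (fun v => expR (- W S * v + 0 * v ^+ 2))
       (expR (- W S * u + 0 * u ^+ 2) * (- W S + 2 * 0 * u)).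
      exact: is_derive_expR_quad.
    have := is_deriveZ (subset_law p S) e.
    rewrite (_ : (_ \*: _) = (fun v => subset_law p S * expR (- v * W S))).
      move=> he; apply: (is_derive_eq he); rewrite /GRing.scale /=; congr (_ * _).
      rewrite mulrC; congr (_ * expR _); ring.
    by apply: boolp.funext => v; congr (_ * expR _); ring.
  exact: (is_deriveM hl (is_derive_expR_quad _ _ _)).
move=> u0; have g0 : 0 < g u by apply: expR_gt0.
have -> : dlap u = - Ex p (fun S => W S * expR (- u * W S)).
  by rewrite -mulN1r -ExZ; apply: eq_bigr => S _ /=; ring.
have := tilted_mean_ge u0; rewrite -/m -/L.
set l := laplace u; set e := Ex p _ => le.
have -> : l * (g u * (m + 2 * (- L / 2) * u)) + g u * - e
  = g u * ((m - u * L) * l - e) by field.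
by rewrite pmulr_rle0 // subr_le0.
Qed.

(** exp(- s X) is a product of decreasing factors exp(- s I_a); after Harris' inequality each factor
    is a Bernoulli transform with E I_a <= 1 - q. *)
Lemma laplace_ge s : 0 <= s <= 5^-1 -> Pimax p Q < 1 ->
  expR (- (s * mu p Q) + (1 - Pimax p Q) / 5 * s ^+ 2 * mu p Q) <= laplace s.
Proof.
move=> /andP[s0 s1] Pi1; set q := 1 - Pimax p Q.
rewrite muE !mulr_sumr -sumrN -big_split /= expR_sum.
rewrite [leRHS](eq_Ex p (g := fun S => \prod_a expR (- s * I a S))); last first.
  by move=> S; rewrite -expR_sum -mulr_sumr.
apply: le_trans (Harris_prod p01 _ _ _); last 2 first.
- move=> a S T ST; rewrite ler_expR !mulNr lerN2.
  by rewrite ler_wpM2l // Ind_increasing.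
- by move=> a S; apply: expR_ge0.
apply: ler_prod => a _; rewrite expR_ge0 /=.
have -> : Ex p (fun S => expR (- s * I a S))
    = 1 - Ex p (I a) + Ex p (I a) * expR (- s).
  rewrite (eq_Ex p (g := fun S => 1 + (expR (- s) - 1) * I a S)).
    by rewrite ExD Ex_cst ExZ; ring.
  by move=> S; rewrite /Ind; case: (_ \subset _); rewrite ?mulr1 ?mulr0 ?expR0; ring.
apply: Bernoulli_laplace_ge; rewrite ?s0 ?s1 ?Ex_Ind_ge0 //= /q; first lra.
by have := Ex_Ind_le_Pimax a; lra.
Qed.

(** * Two lower bounds for the lower tail *)

(** The indicator of X = 0 is the product of the decreasing functions 1 - I_a. *)
Lemma Pr_Xsum0_ge : Pimax p Q < 1 ->
  expR (- (mu p Q / (1 - Pimax p Q))) <= Pr p (fun S => W S == 0).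
Proof.
move=> Pi1; set q := 1 - Pimax p Q; have q0 : 0 < q by rewrite /q; lra.
rewrite PrE [leRHS](eq_Ex p (g := fun S => \prod_a (1 - I a S))); last first.
  move=> S; rewrite /Xsum psumr_eq0; last by move=> a _; case/andP: (Ind01 a S).
  case: (boolP (all _ _)) => [/allP h|].
    rewrite big1 // => a _; have /eqP -> := h a (mem_index_enum a).
    by rewrite subr0.
  case/allPn => a _ /= Ia; rewrite (bigD1 a) //=.
  move: Ia; rewrite /Ind; case: (_ \subset _); last by rewrite eqxx.
  by rewrite subrr mul0r.
apply: le_trans (Harris_prod p01 _ _ _); last 2 first.
- by move=> a S T ST; rewrite lerB // Ind_increasing.
- by move=> a S; case/andP: (Ind01 a S); rewrite subr_ge0.
rewrite muE mulr_suml -sumrN expR_sum; apply: ler_prod => a _.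
rewrite expR_ge0 /=.
have -> : Ex p (fun S => 1 - I a S) = 1 - Ex p (I a).
  rewrite (eq_Ex p (g := fun S => 1 + (- 1) * I a S)).
    by rewrite ExD Ex_cst ExZ mulN1r.
  by move=> S; rewrite mulN1r.
apply: expRN_div_le => //; rewrite Ex_Ind_ge0 /= /q.
by have := Ex_Ind_le_Pimax a; lra.
Qed.

Lemma lower_tail_ge_Pr0 eps : eps <= 1 ->
  Pr p (fun S => W S == 0) <= Pr p (fun S => W S <= (1 - eps) * mu p Q).
Proof.
move=> e1; rewrite !PrE; apply: le_Ex => // S; rewrite ler_nat.
case: eqP => // ->; rewrite mulr_ge0 ?subr_ge0 //; exact: mu_ge0.
Qed.

Lemma lower_tail_ge_tilt eps s : 0 <= eps -> 0 <= s <= 5^-1 -> Pimax p Q < 1 ->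
  (1 - Pimax p Q) / 5 * s = 2 * eps ->
  (s * eps * mu p Q) ^+ 2 * expR (- (2 * s ^+ 2 * Lambda p Q))
  <= Pr p (fun S => W S <= (1 - eps) * mu p Q).
Proof.
move=> e0 s01 Pi1 se; have /andP[s0 _] := s01.
set P := Pr p _; set m := mu p Q; set L := Lambda p Q; set x := s * eps * m.
have m0 : 0 <= m by apply: mu_ge0.
have x0 : 0 <= x by rewrite !mulr_ge0.
pose f S := expR (- s * W S).
pose a := Ex p (fun S => (W S <= (1 - eps) * m)%R%:R * f S).
have fE : Ex p (fun S => f S ^+ 2) = laplace (2 * s).
  by apply: eq_Ex => S; rewrite -expRM_natl; congr expR; ring.
have fB0 : 0 < Ex p (fun S => f S ^+ 2).
  rewrite fE; apply: lt_le_trans (_ : expR (- (2 * s) * #|X|%:R) <= _).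
    exact: expR_gt0.
  rewrite -[leLHS](Ex_cst p); apply: le_Ex => // S.
  rewrite ler_expR !mulNr lerN2 ler_wpM2l ?mulr_ge0 //.
  rewrite /Xsum -sum1_card natr_sum; apply: ler_sum => b _.
  by case/andP: (Ind01 b S).
have a_ge : x * expR (- (s * m)) <= a.
  (* Off the event, X > (1 - eps) m gives exp(- s X) <= exp(- s m + x). *)
  have le1 : laplace s <= a + expR (- (s * m) + x).
    rewrite -[X in _ <= _ + X](Ex_cst p) -ExD; apply: le_Ex => // S.
    rewrite -/(f S); case: (leP (W S)) => [_|lt] /=.
      by rewrite mul1r lerDl expR_ge0.
    rewrite mul0r add0r ler_expR (_ : - (s * m) + x = - s * ((1 - eps) * m)).
      by rewrite !mulNr lerN2 ler_wpM2l // ltW.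
    by rewrite /x; ring.
  have := le_trans (laplace_ge s01 Pi1) le1; rewrite -/m.
  (* The choice of [s] makes the gain in the exponent exactly 2x, against x off the event. What
     remains is exp(- s m) (e^(2x) - e^x) >= x exp(- s m). *)
  rewrite (_ : _ / 5 * s ^+ 2 * m = x + x); last by rewrite expr2 mulrA se /x; ring.
  rewrite !expRD; set E := expR (- _); set e := expR x.
  have : 0 < E by apply: expR_gt0.
  have : 1 + x <= e by apply: expR_ge1Dx.
  move=> e1 E0 h; apply: (@le_trans _ _ (E * (e * e) - E * e)); last lra.
  by rewrite -mulrBr mulrC ler_pM2l //; nra.
have aP : a ^+ 2 <= P * laplace (2 * s).
  by rewrite -fE; apply: Cauchy_Schwarz_event.
have P0 : 0 <= P by apply: sumr_ge0 => S _; apply: subset_law_ge0.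
have s20 : 0 <= 2 * s by lra.
have B_le := Janson_laplace_le s20.
have : (x * expR (- (s * m))) ^+ 2 <= P * expR (- (2 * s * m) + (2 * s) ^+ 2 / 2 * L).
  apply: le_trans (ler_wpM2l P0 B_le); apply: le_trans aP.
  by rewrite lerXn2r // nnegrE ?(le_trans _ a_ge) // mulr_ge0 // expR_ge0.
rewrite exprMn -expRM_natl -ler_pdivrMr ?expR_gt0 // -expRN -[X in X <= _ -> _]mulrA -expRD.
by rewrite (_ : _ - _ = - (2 * s ^+ 2 * L)) //; field.
Qed.

End Family.

(** * Choice of parameters and comparison of constants *)

Theorem theorem2 (R : realType) (Gamma X : finType) (p : Gamma -> R)
    (Q : X -> {set Gamma}) (eps : R)
    (p01 : forall i : Gamma, 0 <= p i <= 1)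
    (Xne : (0 < #|X|)%N)
    (eps01 : 0 <= eps <= 1)
    (Pi_lt1 : Pimax p Q < 1)
    (hmu : eps ^+ 2 * mu p Q
             >= (eps < 1 / 50%:R)%R%:R * (1 + delta p Q) `^ (- (1 / 2%:R))) :
  let K : R := 5000%:R / (1 - Pimax p Q) ^+ 5 in
  let delta' : R := (eps < 1 / 50%:R)%R%:R * delta p Q in
  Pr p (fun S => Xsum R Q S <= (1 - eps) * mu p Q)
    >= expR (- (K * phi (- eps) * mu p Q * (1 + delta')))
  /\ expR (- (K * phi (- eps) * mu p Q * (1 + delta')))
       >= expR (- (K * eps ^+ 2 * mu p Q * (1 + delta'))).
Proof.
set q := 1 - Pimax p Q; set m := mu p Q in hmu *; set d := delta p Q in hmu *.
move=> K d'; have /andP[e0 e1] := eps01.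
have m0 : 0 <= m by apply: mu_ge0.
have d0 : 0 <= d by apply: delta_ge0.
have q0 : 0 < q by rewrite /q subr_gt0.
have q1 : q <= 1 by rewrite /q gerBl Pimax_ge0.
have q50 : 0 < q ^+ 5 by apply: exprn_gt0.
have K0 : 0 <= K by rewrite divr_ge0 // ltW.
have d'0 : 0 <= d' by rewrite mulr_ge0.
have D0 : 0 <= 1 + d' by lra.
split; last first.
  rewrite ler_expR lerN2; do 2 apply: ler_wpM2r => //.
  by apply: ler_wpM2l => //; apply: phiN_le.
(* Half of 5000 is spent on phi(- eps) >= eps^2 / 2. *)
have phi2 : 2500%:R / q ^+ 5 * eps ^+ 2 <= K * phi (- eps).
  have -> : 2500%:R / q ^+ 5 * eps ^+ 2 = K * (eps ^+ 2 / 2).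
    by rewrite /K; field; rewrite gt_eqF.
  by apply: ler_wpM2l => //; apply: phiN_ge.
have big_eps : q ^+ 2 <= 50%:R * eps ->
    expR (- (K * phi (- eps) * m * (1 + d')))
    <= Pr p (fun S => Xsum R Q S <= (1 - eps) * m).
  move=> qe; apply: le_trans (lower_tail_ge_Pr0 Q p01 e1).
  apply: le_trans (Pr_Xsum0_ge p01 Pi_lt1); rewrite ler_expR lerN2 -/q -/m.
  (* Here 2500 eps^2 = (50 eps)^2 >= q^4, which cancels all but one power of q in q^5. *)
  have h : q^-1 <= K * phi (- eps).
    apply: le_trans phi2; rewrite -[leLHS]mul1r ler_pdivrMr //.
    rewrite (_ : _ * q = (50%:R * eps) ^+ 2 / (q ^+ 2) ^+ 2); last first.
      by field; rewrite gt_eqF.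
    rewrite ler_pdivlMr ?exprn_gt0 // mul1r lerXn2r ?nnegrE //.
      exact: sqr_ge0.
    by rewrite mulr_ge0.
  rewrite mulrC; apply: (@le_trans _ _ (K * phi (- eps) * m)).
    exact: ler_wpM2r.
  rewrite ler_peMr ?lerDl // mulr_ge0 //; apply: le_trans h.
  by rewrite invr_ge0 ltW.
have [qe|qe] := leP (q ^+ 2) (50%:R * eps); first exact: big_eps.
(* In the remaining case 50 eps < q^2 <= 1, so both indicators equal 1. The case eps >= 1/50 was
   covered by [big_eps]. *)
have e50 : eps < 1 / 50%:R.
  have : q ^+ 2 <= 1 by rewrite expr_le1 // ltW.
  by lra.
move: hmu; rewrite /d' e50 !mul1r => hmu.
have D1 : 1 <= 1 + d by lra.
pose r := Num.sqrt (1 + d).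
have r2 : r ^+ 2 = 1 + d by rewrite sqr_sqrtr //; lra.
have r1 : 1 <= r by rewrite -[1](@sqrtr1 R) ler_sqrt //; lra.
have r0 : 0 < r by lra.
have hr : r^-1 <= eps ^+ 2 * m.
  by move: hmu; rewrite powRN powR12_sqrt //; lra.
have emr : 1 <= eps ^+ 2 * m * r by rewrite -ler_pdivrMr // div1r.
(* This [s] solves (q / 5) s = 2 eps, and 50 eps < q^2 <= q gives s <= 1/5. *)
pose s := 10%:R * eps / q.
have s01 : 0 <= s <= 5^-1.
  rewrite /s divr_ge0 ?mulr_ge0 ?(ltW q0) //= ler_pdivrMr //.
  have : q ^+ 2 <= q by rewrite expr2 ler_piMr // ltW.
  by lra.
have se : q / 5 * s = 2 * eps by rewrite /s; field; rewrite gt_eqF.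
apply: le_trans (lower_tail_ge_tilt p01 e0 s01 Pi_lt1 se).
rewrite -/m (LambdaE Q p01) -/d -/m; set x := s * eps * m.
have xr : r^-1 <= x.
  have -> : x = 10%:R / q * (eps ^+ 2 * m) by rewrite /x /s; field; rewrite gt_eqF.
  apply: le_trans hr _; rewrite ler_peMl ?mulr_ge0 ?sqr_ge0 //.
  by rewrite ler_pdivlMr // mul1r; lra.
have er : expR (- r) <= r^-1.
  by rewrite expRN lef_pV2 ?posrE ?expR_gt0 //; have := expR_ge1Dx r; lra.
(* The prefactor is traded for an exponential: x >= 1/r >= exp(- r). *)
have x2 : expR (- (2 * r)) <= x ^+ 2.
  rewrite -mulrN expRM_natl lerXn2r ?nnegrE ?expR_ge0 //; last exact: le_trans xr.
  by rewrite (le_trans _ xr) // invr_ge0 ltW.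
apply: le_trans (ler_wpM2r (expR_ge0 _) x2).
rewrite -expRD ler_expR -opprD lerN2.
(* The trade is affordable because G = (eps^2 m r) r >= r. *)
set G := eps ^+ 2 * m * (1 + d).
have G_r : r <= G.
  by rewrite /G -r2 expr2 !mulrA ler_peMl // ltW.
have G0 : 0 <= G by lra.
apply: (@le_trans _ _ (2500%:R / q ^+ 5 * eps ^+ 2 * (m * (1 + d)))); last first.
  rewrite -[leRHS]mulrA; apply: ler_wpM2r => //; rewrite mulr_ge0 //; lra.
have -> : 2500%:R / q ^+ 5 * eps ^+ 2 * (m * (1 + d)) = 2500%:R / q ^+ 5 * G.
  by rewrite /G; ring.
have -> : 2 * s ^+ 2 * ((1 + d) * m) = 200%:R / q ^+ 2 * G.
  by rewrite /s /G; field; rewrite gt_eqF.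
have i5 : 1 <= (q ^+ 5)^-1 by rewrite invf_ge1 // exprn_ile1 // ltW.
have i2 : (q ^+ 2)^-1 <= (q ^+ 5)^-1.
  by rewrite lef_pV2 ?posrE ?exprn_gt0 // (exprD q 2 3) ler_piMr ?sqr_ge0 // exprn_ile1 // ltW.
(* The exponent 2r + 2 s^2 Lambda is at most (2 + 200 / q^2) G, and 2 + 200 / q^2 <= 202 / q^5, well
   below 2500 / q^5. *)
apply: (@le_trans _ _ ((2 + 200%:R / q ^+ 2) * G)); first lra.
by apply: ler_wpM2r => //; lra.
Qed.
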